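(* Let $g:\mathcal{H}\to\mathbb{R}$ be a (measurable) functional that is square integrable with respect to the prior $\mu_0$, i.e. $\int_{\mathcal{H}} |g(u)|^2\,\mu_0(\mathrm{d}u)<\infty$. For any finite $t\ge 0$, let $u_t\sim\mu_t$ be an $\mathcal{H}$-valued random variable, where $\mu_t$ is the tempered probability measure defined in the context. Then the expected value $\mathbb{E}\{g(u_t)\}=\int_{\mathcal{H}} g(u)\,\mu_t(\mathrm{d}u)$, as a function of $t\in[0,\infty)$, is differentiable (with one-sided derivative at $t=0$), and its derivative satisfies $$\frac{\mathrm{d}}{\mathrm{d}t}\,\mathbb{E}\{g(u_t)\} = -\mathrm{Cov}\{g(u_t),\Phi(u_t;y)\}.$$
   Context: $\mathcal{H}$ is a real separable Hilbert space with norm $\|\cdot\|_{\mathcal{H}}$ and Borel sigma-algebra $\mathcal{B}(\mathcal{H})$, and $\mu_0=\mathcal{N}(m,\mathcal{C})$ is a Gaussian probability measure on $(\mathcal{H},\mathcal{B}(\mathcal{H}))$ (the prior). $M$ is a positive integer, $y\in\mathbb{R}^M$ is fixed, $\Gamma$ is a symmetric positive definite $M\times M$ matrix, and $\|\cdot\|$ is the Euclidean norm on $\mathbb{R}^M$. The forward map $\mathcal{G}:\mathcal{H}\to\mathbb{R}^M$ is assumed to satisfy: (1) for every $\epsilon>0$ there is $\beta=\beta(\epsilon)\in\mathbb{R}$ such that $\|\Gamma^{-1/2}\mathcal{G}(u)\|\le \exp(\epsilon\|u\|_{\mathcal{H}}^2+\beta)$ for all $u\in\mathcal{H}$; (2)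 for every $r>0$ there is $K=K(r)>0$ such that $\|\Gamma^{-1/2}(\mathcal{G}(u_1)-\mathcal{G}(u_2))\|\le K\|u_1-u_2\|_{\mathcal{H}}$ for all $u_1,u_2\in\mathcal{H}$ with $\max\{\|u_1\|_{\mathcal{H}},\|u_2\|_{\mathcal{H}}\}<r$. The data misfit is $\Phi(u;y)=\frac12\|\Gamma^{-1/2}(y-\mathcal{G}(u))\|^2$. For finite $t\ge 0$, $\mu_t$ is the probability measure on $(\mathcal{H},\mathcal{B}(\mathcal{H}))$ with $$\frac{\mathrm{d}\mu_t}{\mathrm{d}\mu_0}(u)=N_t^{-1}\exp(-t\Phi(u;y)),\qquad N_t=\int_{\mathcal{H}}\exp(-t\Phi(u;y))\,\mu_0(\mathrm{d}u).$$ $\mathrm{Cov}\{X,Y\}=\mathbb{E}\{XY\}-\mathbb{E}\{X\}\mathbb{E}\{Y\}$ denotes the covariance of two real random variables. *)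

(* Defs.v *)
From HB Require Import structures.
From mathcomp Require Import all_boot all_order all_algebra sesquilinear.
From mathcomp Require Import all_classical all_reals all_analysis.

Set Implicit Arguments.
Unset Strict Implicit.
Unset Printing Implicit Defensive.

Import Order.TTheory GRing.Theory Num.Theory.
Import numFieldNormedType.Exports.

Local Open Scope classical_set_scope.
Local Open Scope ring_scope.

Notation borel T := (g_sigma_algebraType (@open T)).

Definition separable_space (T : topologicalType) :=
  exists2 A : set T, countable A & dense A.

(* A real Hilbert space is a complete normed module [H] together with an inner
   product that induces the norm of [H]. *)
Definition hilbert_inner (R : realType) (H : completeNormedModType R)
    (inner : {dot H for idfun}) :=
  forall u : H, inner u u = `|u| ^+ 2.

(* [v] is the variance.  The null variance is treated apart because
   [normal_prob a 0] is a uniform distribution in the library. *)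
Definition gaussian1 (R : realType) (a v : R) : set R -> \bar R :=
  if v == 0 then \d_a else normal_prob a (Num.sqrt v).

(* mu = N(m, C): every continuous linear functional <., h> has under mu the law
   N(<m, h>, <C h, h>) on the line, possibly degenerate.  That C is trace-class
   is a consequence. *)
Definition is_gaussian (R : realType) (H : completeNormedModType R)
    (inner : {dot H for idfun}) (mu : probability (borel H) R)
    (m : H) (C : {linear H -> H}) :=
  [/\ continuous C,
      forall h k, inner (C h) k = inner h (C k),
      forall h, 0 <= inner (C h) h &
      forall (h : H) (A : set R), measurable A ->
        pushforward mu (fun u : borel H => inner u h) A =
        gaussian1 (inner m h) (inner (C h) h) A].

(* The library norm on matrices is the sup norm. *)
Definition enorm (R : realType) (n : nat) (v : 'cV[R]_n) : R :=
  Num.sqrt (\sum_(i < n) v i 0 ^+ 2).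

Definition posdefmx (R : realType) (n : nat) (A : 'M[R]_n) :=
  A^T = A /\ forall v : 'cV[R]_n, v != 0 -> 0 < (v^T *m A *m v) 0 0.

(* A^{-1/2}: the unique symmetric positive definite square root of A^{-1}; it
   exists when A is symmetric positive definite, otherwise the value may be the
   default 0. *)
Definition inv_sqrtmx (R : realType) (n : nat) (A : 'M[R]_n) : 'M[R]_n :=
  xget 0 [set S | posdefmx S /\ S *m S = invmx A].

Definition misfit (R : realType) (H : Type) (M : nat) (Gamma : 'M[R]_M)
    (G : H -> 'cV[R]_M) (y : 'cV[R]_M) (u : H) : R :=
  2^-1 * enorm (inv_sqrtmx Gamma *m (y - G u)) ^+ 2.

Definition tempered_const (R : realType) (d : measure_display)
    (T : measurableType d) (mu0 : probability T R) (Phi : T -> R) (t : R) : R :=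
  \int[mu0]_u expR (- (t * Phi u)).

(* d mu / d mu0 = N_t^-1 exp (- t Phi). *)
Definition is_tempered (R : realType) (d : measure_display)
    (T : measurableType d) (mu0 : probability T R) (Phi : T -> R) (t : R)
    (mu : probability T R) :=
  forall A : set T, measurable A ->
    mu A = (\int[mu0]_(u in A)
      ((tempered_const mu0 Phi t)^-1 * expR (- (t * Phi u)))%:E)%E.

(* Main.v *)
Require Import Defs.
From HB Require Import structures.
From mathcomp Require Import all_boot all_order all_algebra sesquilinear.
From mathcomp Require Import all_classical all_reals all_analysis.
From mathcomp Require Import measurable_realfun ring lra.
Set Implicit Arguments.
Unset Strict Implicit.
Unset Printing Implicit Defensive.
Import Order.TTheory GRing.Theory Num.Theory.
Import numFieldNormedType.Exports.
Local Open Scope classical_set_scope.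
Local Open Scope ring_scope.

(** Write [N t] for the integral of [exp (- t Phi)] and [A t] for that of
    [g exp (- t Phi)], both under the Gaussian prior, so that the mean of [g]
    under the tempered measure is [A t / N t].  If differentiation under the
    integral sign is legitimate, [A' t] is minus the integral of
    [g Phi exp (- t Phi)] and [N' t] is minus that of [Phi exp (- t Phi)], and
    the quotient rule gives [- (E (g Phi) - E g * E Phi)], which is minus the
    covariance.

    Differentiation is justified by the second order bound
    [|exp (- y) - exp (- x) + (y - x) exp (- x)| <= (y - x)^2] for nonnegative
    [x] and [y] (expRN_taylor2).  Integrated against [g], it leaves a remainder
    at most [(s - t)^2] times the integral of [|g| Phi^2], for all [s] and [t]
    in [0, +oo[ (tilt_remainder).  As nothing changes at the boundary, one
    argument along a filter gives the derivative at [t > 0] and the one-sided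
    derivative at [t = 0].  Since [g] is square integrable, it remains to see
    that [Phi] has a finite fourth moment under the prior
    (integrable_mul_pow).  By the growth hypothesis [Phi^4] is at most a constant
    times [exp (al |u|^2)], with [al > 0] as small as desired, so this is
    Fernique's theorem (gaussian_exp_moment).

    In a separable Hilbert space that theorem needs only the laws of the single
    functionals [<u, h>], which is all that the definition of a Gaussian measure
    gives.  Let [X_e = <u - m, e>], with variance [lam_e = <C e, e>], where [e]
    ranges over a finite orthonormal family.
    - The sums [T = sum_e lam_e] are bounded.  Indeed [|X_e|] exceeds
      [sqrt lam_e / 2] with probability at least [1/2], so the sum of the
      [lam_e] over the coordinates where this happens has mean at least [T / 2];
      it is also at most [4 |u - m|^2] by Bessel, and that is bounded off an
      event of small probability (gaussian_trace_bounded).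
    - Convexity of [exp] with weights [lam_e / T] bounds
      [exp (ep * sum_e X_e^2)] by the mean of the
      [exp (ep * T * X_e^2 / lam_e)], whose expectations are at most [2] when
      [ep * T <= 1/4] (coord_exp_moment, gaussian1_exp_moment).
    Gram-Schmidt applied to a dense sequence and monotone convergence then turn
    [sum_e X_e^2] into [|u - m|^2]. *)

(** * Tangents to the exponential *)

Lemma expR_tangent (R : realType) (z x : R) : expR z * (1 + (x - z)) <= expR x.
Proof.
have -> : expR x = expR z * expR (x - z) by rewrite -expRD addrC subrK.
by rewrite ler_wpM2l ?expR_ge0 ?expR_ge1Dx.
Qed.

(** Tangent lines to [exp] at the barycenter; the missing mass [1 - \sum w] is
    put at [0]. *)
Lemma expR_sum_le (R : realType) (I : Type) (s : seq I) (w y : I -> R) :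
    (forall i, 0 <= w i) -> \sum_(i <- s) w i <= 1 ->
  expR (\sum_(i <- s) w i * y i) <=
    \sum_(i <- s) w i * expR (y i) + (1 - \sum_(i <- s) w i).
Proof.
move=> w0; set W := \sum_(i <- s) w i => W1; set z := \sum_(i <- s) _.
have t0 := expR_tangent z 0; rewrite expR0 in t0.
have -> : expR z = expR z * (W + z - W * z) + (1 - W) * (expR z * (1 + (0 - z))).
  by ring.
apply: lerD; last by rewrite -[leRHS]mulr1 ler_wpM2l ?subr_ge0.
have -> : expR z * (W + z - W * z) = \sum_(i <- s) w i * (expR z * (1 + (y i - z))).
  transitivity (\sum_(i <- s) (expR z * (1 - z) * w i + expR z * (w i * y i))).
    by rewrite big_split/= -!mulr_sumr -/W -/z; ring.
  by apply: eq_bigr => i _; ring.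
by apply: ler_sum => i _; rewrite ler_wpM2l// expR_tangent.
Qed.

(** The tangents at [x] and at [y] bound the difference of the two exponentials
    on both sides. *)
Lemma expRN_taylor2 (R : realType) (x y : R) : 0 <= x -> 0 <= y ->
  `|expR (- y) - expR (- x) + (y - x) * expR (- x)| <= (y - x) ^+ 2.
Proof.
move=> x0 y0; set a := expR (- x); set b := expR (- y).
have a0 : 0 <= a by exact: expR_ge0.
have b0 : 0 <= b by exact: expR_ge0.
have a1 : a <= 1 by rewrite -expR0 ler_expR oppr_le0.
have b1 : b <= 1 by rewrite -expR0 ler_expR oppr_le0.
have ab : a * (1 + (- y - - x)) <= b by exact: expR_tangent.
have ba : b * (1 + (- x - - y)) <= a by exact: expR_tangent.
have -> : b - a + (y - x) * a = b - a * (1 + (- y - - x)) by ring.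
rewrite ger0_norm ?subr_ge0//.
have up : b - a * (1 + (- y - - x)) <= (y - x) * (a - b).
  by nra.
apply: le_trans up _; rewrite expr2.
have [xy|xy] := leP x y.
  rewrite ler_wpM2l ?subr_ge0//.
  by apply: (@le_trans _ _ (a * (y - x))); [nra|rewrite ler_piMl// subr_ge0].
rewrite -mulrNN -[leRHS]mulrNN ler_wpM2l ?oppr_ge0 ?subr_le0 ?(ltW xy)//.
by apply: (@le_trans _ _ (b * (x - y))); [nra|rewrite opprB ler_piMl// subr_ge0 ltW].
Qed.

(** * Measures with a density *)

Section density.
Context d (T : measurableType d) (R : realType).
Variables (mu nu : {measure set T -> \bar R}) (rho : T -> R).
Hypothesis mrho : measurable_fun [set: T] rho.
Hypothesis rho0 : forall x, 0 <= rho x.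
Hypothesis nuE : forall A, measurable A ->
  nu A = (\int[mu]_(x in A) (rho x)%:E)%E.

Import HBNNSimple.

(** Approximating [f] from below by simple functions reduces the claim to
    [nuE] on the preimages of their values. *)
Lemma ge0_integral_density (f : T -> \bar R) :
    measurable_fun [set: T] f -> (forall x, (0 <= f x)%E) ->
  (\int[nu]_x f x = \int[mu]_x (f x * (rho x)%:E))%E.
Proof.
move=> mf f0; pose h := nnsfun_approx measurableT mf.
have mrhoE : measurable_fun [set: T] (EFin \o rho) by exact/measurable_EFinP.
have hf x : EFin (h n x) @[n --> \oo] --> f x.
  by apply: cvg_nnsfun_approx => // ? _; exact: f0.
have mh n : measurable_fun [set: T] (EFin \o h n) by exact/measurable_EFinP.
have hnd x : {homo (fun n => EFin (h n x)) : a b / (a <= b)%N >-> (a <= b)%E}.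
  by move=> a b ab; rewrite lee_fin; exact/lefP/nd_nnsfun_approx.
have h0 n x : (0 <= (h n x)%:E)%E by rewrite lee_fin.
have -> : (\int[nu]_x f x = limn (fun n => \int[nu]_x (h n x)%:E))%E.
  rewrite -monotone_convergence//.
  by apply: eq_integral => x _; apply/esym/cvg_lim => //; exact: hf.
have -> : (\int[mu]_x (f x * (rho x)%:E) =
           limn (fun n => \int[mu]_x ((h n x)%:E * (rho x)%:E)))%E.
  rewrite -monotone_convergence//.
  - apply: eq_integral => x _; apply/esym/cvg_lim => //.
    by apply: cvgeZr.
  - by move=> n; exact: (emeasurable_funM (mh n) mrhoE).
  - by move=> n x _; rewrite mule_ge0// lee_fin.
  - by move=> x _ a b ab; rewrite lee_wpmul2r ?lee_fin//; exact: hnd.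
congr (limn _); apply/funext => n.
have mpre y : measurable (h n @^-1` [set y]) by [].
have mind y : measurable_fun [set: T] (fun x => (y * \1_(h n @^-1` [set y]) x)%:E).
  by apply/measurable_EFinP; apply: measurable_funM => //; exact: measurable_indic.
transitivity (\int[nu]_x
   (\sum_(y \in range (h n)) (y * \1_(h n @^-1` [set y]) x)%:E))%E.
  by apply: eq_integral => t _; rewrite /= fimfunE -fsumEFin.
rewrite ge0_integral_fsum//; last by move=> m y _; exact: nnfun_muleindic_ge0.
transitivity (\int[mu]_x (\sum_(y \in range (h n))
    (y * \1_(h n @^-1` [set y]) x)%:E * (rho x)%:E))%E; last first.
  apply: eq_integral => x _.
  rewrite -ge0_mule_fsuml => [|y]; last exact: nnfun_muleindic_ge0.
  by rewrite fsumEFin // -(fimfunE _ x).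
rewrite ge0_integral_fsum//; last 2 first.
- by move=> y; exact: (emeasurable_funM (mind y) mrhoE).
- by move=> y x _; rewrite mule_ge0 ?lee_fin//; exact: nnfun_muleindic_ge0.
apply: eq_fsbigr => r _.
rewrite integralZl_indic_nnsfun// integral_indic// setIT nuE//.
rewrite integral_mkcond.
under [RHS]eq_integral => x _ do rewrite EFinM -muleA.
have [r0|r0] := leP 0 r.
- rewrite ge0_integralZl_EFin//.
  + congr (_ * _)%E; apply: eq_integral => x _.
    by rewrite patchE indicE; case: ifPn; rewrite ?mul1e ?mul0e.
  + by move=> x _; rewrite mule_ge0 ?lee_fin.
  + apply: emeasurable_funM => //.
    by apply/measurable_EFinP; exact: measurable_indic.
- have -> : h n @^-1` [set r] = set0 by apply: preimage_nnfun0.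
  rewrite patch_set0 integral0 mule0; apply/esym/integral0_eq => x _.
  by rewrite indic0 mul0e mule0.
Qed.

Lemma integrable_density (f : T -> R) : measurable_fun [set: T] f ->
  mu.-integrable [set: T] (fun x => (f x * rho x)%:E) ->
  nu.-integrable [set: T] (EFin \o f).
Proof.
move=> mf /integrableP[_ h]; apply/integrableP; split.
  exact/measurable_EFinP.
rewrite ge0_integral_density//.
- apply: le_lt_trans h; rewrite le_eqVlt; apply/orP; left; apply/eqP.
  by apply: eq_integral => x _; rewrite /= normrM (ger0_norm (rho0 x)) -EFinM.
- by apply: measurableT_comp => //; exact/measurable_EFinP.
Qed.

(** A nonnegative density commutes with positive and negative parts, so both
    sides are differences of the same nonnegative integrals, integrable or
    not. *)
Lemma integral_density (f : T -> R) : measurable_fun [set: T] f ->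
  (\int[nu]_x (f x)%:E = \int[mu]_x (f x * rho x)%:E)%E.
Proof.
move=> mf; have mfE : measurable_fun [set: T] (EFin \o f) by exact/measurable_EFinP.
rewrite integralE [RHS]integralE !ge0_integral_density//.
- congr (_ - _)%E; apply: eq_integral => x _ /=.
    rewrite !funeposE -!EFin_max -EFinM; congr EFin.
    by rewrite maxr_pMl// mul0r.
  rewrite !funenegE -!EFinN -!EFin_max -EFinM; congr EFin.
  by rewrite maxr_pMl// mul0r mulNr.
- exact: measurable_funeneg.
- exact: measurable_funepos.
Qed.

End density.

(** * Gaussian laws on the line *)

Section gaussian1.
Context d (T : measurableType d) (R : realType) (P : probability T R).
Variables (X : T -> R) (a v : R).
Hypothesis mX : measurable_fun [set: T] X.
Hypothesis v0 : 0 <= v.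
Hypothesis lawX : forall A : set R, measurable A ->
  pushforward P X A = gaussian1 a v A.

Lemma ge0_integral_gaussian1 (f : R -> R) :
    measurable_fun [set: R] f -> (forall x, 0 <= f x) ->
  (\int[P]_w (f (X w))%:E = if (v == 0)%R then (f a)%:E else
     \int[lebesgue_measure]_x (f x * normal_pdf a (Num.sqrt v) x)%:E)%E.
Proof.
(* [normal_prob] integrates over this copy of the line, with the same
   sigma-algebra. *)
pose L := measurableTypeR R; pose Y : T -> L := X.
move=> mf f0; have mfE : measurable_fun [set: L] (EFin \o f) by exact/measurable_EFinP.
have mY : measurable_fun [set: T] Y := mX.
transitivity (\int[pushforward P Y]_x (f x)%:E)%E.
  by rewrite ge0_integral_pushforward// => x _; rewrite lee_fin.
have lawY A : measurable A -> pushforward P Y A = gaussian1 a v A := @lawX A.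
have [ve|ve] := eqVneq v 0.
  rewrite (@eq_measure_integral _ _ _ _ (\d_(a : L))); last first.
    move=> A mA _; rewrite -[LHS]/(pushforward P Y A) lawY//.
    by rewrite /gaussian1 ve eqxx.
  by rewrite integral_dirac// diracT mul1e.
under [RHS]eq_integral do rewrite EFinM.
apply: (@ge0_integral_density _ L R lebesgue_measure _
  (normal_pdf a (Num.sqrt v)) _ _ _ (EFin \o f)) => //.
- exact: measurable_normal_pdf.
- exact: normal_pdf_ge0.
- move=> A mA; rewrite -[LHS]/(pushforward P Y A) lawY//.
  by rewrite /gaussian1 (negbTE ve).
Qed.

(** For [c * v <= 1/4] the weight [exp (c (x - a)^2)] absorbs at most half of the
    Gaussian exponent, which leaves [sqrt 2] times the density of variance
    [2 v].  The bound does not depend on [v], which is what the convexity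
    argument for the norm needs. *)
Lemma gaussian1_exp_moment (c : R) : 0 <= c -> c * v <= 4^-1 ->
  (\int[P]_w (expR (c * (X w - a) ^+ 2))%:E <= 2%:E)%E.
Proof.
move=> c0 cv.
have mc : measurable_fun [set: R] (fun x => expR (c * (x - a) ^+ 2)).
  apply: measurableT_comp => //; apply: measurable_funM => //.
  by apply: measurable_funX; exact: measurable_funB.
rewrite (ge0_integral_gaussian1 mc) => [|x]; last exact: expR_ge0.
case: ifPn => [_|ve].
  by rewrite subrr expr0n mulr0 expR0 lee_fin ler1n.
have v_gt0 : 0 < v by rewrite lt_neqAle eq_sym ve.
have s0 : Num.sqrt v != 0 by rewrite sqrtr_eq0 -ltNge.
have s20 : Num.sqrt (2 * v) != 0 by rewrite sqrtr_eq0 -ltNge mulr_gt0.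
apply: (@le_trans _ _ (\int[lebesgue_measure]_x
   ((Num.sqrt 2)%:E * (normal_pdf a (Num.sqrt (2 * v)) x)%:E)))%E; last first.
  rewrite ge0_integralZl_EFin ?sqrtr_ge0//.
  - rewrite integral_normal_pdf mule1 lee_fin.
    by rewrite -ler_sqr ?nnegrE ?sqrtr_ge0// sqr_sqrtr//; lra.
  - by move=> x _; rewrite lee_fin normal_pdf_ge0.
  - by apply/measurable_EFinP; exact: measurable_normal_pdf.
apply: ge0_le_integral => //.
- by move=> x _; rewrite lee_fin mulr_ge0 ?expR_ge0 ?normal_pdf_ge0.
- apply/measurable_EFinP; apply: measurable_funM => //.
  exact: measurable_normal_pdf.
- by apply/measurable_EFinP/measurable_funM => //; exact: measurable_normal_pdf.
- move=> x _; rewrite -EFinM lee_fin !normal_pdfE// /normal_peak /normal_fun.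
  rewrite !sqr_sqrtr ?mulr_ge0//.
  have -> : Num.sqrt 2 * ((Num.sqrt (2 * v * pi *+ 2))^-1 * 
     expR (- (x - a) ^+ 2 / (2 * v *+ 2))) =
     (Num.sqrt (v * pi *+ 2))^-1 * expR (- (x - a) ^+ 2 / (2 * v *+ 2)).
    rewrite mulrA; congr (_ * _).
    rewrite -(mulrA 2) -mulrnAr sqrtrM// invfM mulrA divff ?mul1r//.
  rewrite mulrCA ler_wpM2l ?invr_ge0// -expRD ler_expR.
  rewrite -subr_ge0.
  have -> : - (x - a) ^+ 2 / (2 * v *+ 2) -
    (c * (x - a) ^+ 2 + - (x - a) ^+ 2 / (v *+ 2)) = (x - a) ^+ 2 / v * (4^-1 - c * v).
    by field.
  by rewrite mulr_ge0 ?divr_ge0 ?sqr_ge0// subr_ge0.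
Qed.

(** The density is at most [1 / (2 sqrt v)], so the interval of length [sqrt v]
    around the mean has mass at most [1/2]. *)
Lemma gaussian1_spread : 0 < v ->
  (2^-1%:E <= P [set w | (v < 4 * (X w - a) ^+ 2)%R])%E.
Proof.
move=> v_gt0; have s0 : Num.sqrt v != 0 by rewrite sqrtr_eq0 -ltNge.
pose s := Num.sqrt v; have sp : 0 < s by rewrite sqrtr_gt0.
pose I := `[a - s / 2, a + s / 2]%classic : set R.
have mI : measurable I by exact: measurable_itv.
have mXI : measurable (X @^-1` I) by rewrite -[X in measurable X]setTI; exact: mX.
have -> : [set w | v < 4 * (X w - a) ^+ 2] = ~` (X @^-1` I).
  apply/seteqP; split=> w; rewrite /I /= in_itv/=.
    move=> h /andP[h1 h2]; move: h; apply/negP; rewrite -leNgt.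
    rewrite -(sqr_sqrtr v0) -/s; nra.
  move=> /negP; apply: contraR; rewrite -leNgt -(sqr_sqrtr v0) -/s => h.
  have : `|2 * (X w - a)| <= s.
    rewrite -ler_sqr ?nnegrE ?(ltW sp)// real_normK ?num_real//.
    by rewrite exprMn; move: h; lra.
  rewrite ler_norml => /andP[h1 h2]; apply/andP; split; lra.
rewrite probability_setC// leeBrDr; last by rewrite fin_num_measure.
have -> : P (X @^-1` I) = gaussian1 a v I by rewrite -lawX.
rewrite /gaussian1 gt_eqF// /normal_prob.
apply: (@le_trans _ _ (2^-1%:E + 2^-1%:E)%E); last first.
  by rewrite -EFinD lee_fin; lra.
apply: leeD => //.
apply: (@le_trans _ _ (\int[lebesgue_measure]_(x in I) (cst ((2 * s)^-1)%:E x))%E).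
  apply: ge0_le_integral => //.
  - by move=> x _; rewrite lee_fin normal_pdf_ge0.
  - by apply/measurable_EFinP/measurable_funTS; exact: measurable_normal_pdf.
  - move=> x _; rewrite lee_fin; apply: le_trans (normal_pdf_ub _ _ _) _ => //.
    have pk : 0 < s ^+ 2 * pi *+ 2.
      by rewrite pmulrn_lgt0// mulr_gt0 ?pi_gt0 ?exprn_gt0.
    rewrite /normal_peak -/s lef_pV2 ?posrE ?mulr_gt0 ?sqrtr_gt0//.
    rewrite -ler_sqr ?nnegrE ?sqrtr_ge0 ?mulr_ge0 ?(ltW sp)//.
    rewrite sqr_sqrtr ?(ltW pk)// exprMn.
    by have := @pi_ge2 R; have := exprn_gt0 2 sp; nra.
rewrite integral_cst// /I /= lebesgue_measure_itv /=.
rewrite lte_fin ifT; last by lra.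
rewrite -EFinD -EFinM lee_fin.
suff -> : (2 * s)^-1 * (a + s / 2 - (a - s / 2)) = 2^-1 by [].
by field; rewrite gt_eqF.
Qed.

End gaussian1.

(** * Orthonormalization and Parseval *)

Section inner_product.
Context (R : realType) (H : completeNormedModType R) (inner : {dot H for idfun}).
Hypothesis innerE : hilbert_inner inner.

Lemma innerC u v : inner u v = inner v u.
Proof. by rewrite (@hermitian_subproof _ _ _ _ inner) expr0 mul1r. Qed.

Lemma innerBl u v w : inner (u - v) w = inner u w - inner v w.
Proof. exact: linearBl. Qed.

Lemma innerDl u v w : inner (u + v) w = inner u w + inner v w.
Proof. exact: linearDl. Qed.

Lemma innerZl c u w : inner (c *: u) w = c * inner u w.
Proof. exact: linearZl_LR. Qed.

Lemma inner0l w : inner 0 w = 0. Proof. exact: linear0l. Qed.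

Lemma inner_suml (s : seq H) (F : H -> H) w :
  inner (\sum_(e <- s) F e) w = \sum_(e <- s) inner (F e) w.
Proof. exact: linear_sumlz. Qed.

Lemma innerBr u v w : inner w (u - v) = inner w u - inner w v.
Proof. by rewrite innerC innerBl !(innerC w). Qed.

Lemma inner_sqrD u v :
  inner (u + v) (u + v) = inner u u + 2 * inner u v + inner v v.
Proof.
by rewrite innerDl (innerC u (u + v)) (innerC v (u + v)) !innerDl (innerC v u); ring.
Qed.

Lemma normr_inner u : `|u| ^+ 2 = inner u u. Proof. by rewrite innerE. Qed.

Lemma inner_ge0 u : 0 <= inner u u. Proof. by rewrite innerE sqr_ge0. Qed.

(** Polarization makes the inner product a combination of norms. *)
Lemma inner_continuous h : continuous (inner^~ h).
Proof.
have -> : inner^~ h = fun u => 4^-1 * (`|u + h| ^+ 2 - `|u - h| ^+ 2).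
  apply/funext => u; rewrite !normr_inner innerBl !innerBr innerDl.
  by rewrite (innerC u (u + h)) (innerC h (u + h)) !innerDl (innerC h u); field.
move=> u; apply: cvgM; first exact: cvg_cst.
apply: cvgB.
  apply: (cvg_comp _ (fun x : R => x ^+ 2)); last exact: exprn_continuous.
  by apply: cvg_norm; apply: cvgD; [exact: cvg_id|exact: cvg_cst].
apply: (cvg_comp _ (fun x : R => x ^+ 2)); last exact: exprn_continuous.
by apply: cvg_norm; apply: cvgB; [exact: cvg_id|exact: cvg_cst].
Qed.

Definition coord_sum (s : seq H) x : H := \sum_(e <- s) inner x e *: e.

Definition coord_sqr (s : seq H) x : R := \sum_(e <- s) inner x e ^+ 2.

(** The property of orthonormal families that the proofs use: subtracting
    [coord_sum s x] projects [x] onto the orthogonal of [s].  Null vectors are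
    allowed in [s], so that Gram-Schmidt need not discard dependent vectors. *)
Definition orthoproj (s : seq H) :=
  forall x e, e \in s -> inner (x - coord_sum s x) e = 0.

Section projection.
Variable s : seq H.
Hypothesis os : orthoproj s.

Lemma orthoproj_sum x y : inner (x - coord_sum s x) (coord_sum s y) = 0.
Proof.
rewrite innerC inner_suml big_seq big1// => e es.
by rewrite innerZl (innerC e) os// mulr0.
Qed.

Lemma normr_sub_coord_sum x :
  `|x - coord_sum s x| ^+ 2 = `|x| ^+ 2 - coord_sqr s x.
Proof.
rewrite normr_inner innerBr orthoproj_sum subr0 innerBl normr_inner; congr (_ - _).
by rewrite inner_suml; apply: eq_bigr => e _; rewrite innerZl innerC expr2.
Qed.

Lemma bessel x : coord_sqr s x <= `|x| ^+ 2.
Proof. by rewrite -subr_ge0 -normr_sub_coord_sum sqr_ge0. Qed.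

(** The projection is the best approximation from the span of [s], which
    [coord_sum s w = w] expresses without mentioning the span. *)
Lemma coord_sum_approx x w : coord_sum s w = w ->
  `|x| ^+ 2 - coord_sqr s x <= `|x - w| ^+ 2.
Proof.
move=> sw; rewrite -normr_sub_coord_sum.
set p := coord_sum s x.
have -> : x - w = (x - p) + (p - w) by rewrite addrA subrK.
have xp : inner (x - p) (p - w) = 0.
  by rewrite innerBr -sw !orthoproj_sum subrr.
by rewrite !normr_inner (inner_sqrD (x - p)) xp mulr0 addr0 lerDl inner_ge0.
Qed.

End projection.

(** As [0^-1 = 0], a vector already in the span is replaced by [0]. *)
Definition gs_step (s : seq H) (a : H) : H :=
  `|a - coord_sum s a|^-1 *: (a - coord_sum s a).

Fixpoint gram_schmidt (a : nat -> H) (n : nat) : seq H :=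
  if n is k.+1 then gs_step (gram_schmidt a k) (a k) :: gram_schmidt a k
  else [::].

Lemma gs_step_ortho s a e : orthoproj s -> e \in s -> inner (gs_step s a) e = 0.
Proof. by move=> os es; rewrite innerZl os// mulr0. Qed.

Lemma gs_step_ortho_sum s a x : orthoproj s ->
  inner (coord_sum s x) (gs_step s a) = 0.
Proof.
by move=> os; rewrite inner_suml big_seq big1// => e es;
  rewrite innerZl (innerC e) gs_step_ortho// mulr0.
Qed.

Lemma gs_step_unit s a x :
  inner x (gs_step s a) * inner (gs_step s a) (gs_step s a) = inner x (gs_step s a).
Proof.
rewrite /gs_step; set r := a - _; have [->|r0] := eqVneq r 0.
  by rewrite normr0 invr0 scale0r (innerC x) inner0l mul0r.
rewrite -[RHS]mulr1; congr (_ * _); rewrite innerZl (innerC r) innerZl -normr_inner.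
by rewrite expr2 mulKf ?normr_eq0// mulVf// normr_eq0.
Qed.

Lemma orthoproj_gs_step s a : orthoproj s -> orthoproj (gs_step s a :: s).
Proof.
move=> os x e; rewrite /coord_sum big_cons -/(coord_sum s x).
rewrite opprD addrCA addrC innerBl innerZl inE => /orP[/eqP ->|es].
  by rewrite innerBl gs_step_ortho_sum// subr0 gs_step_unit subrr.
by rewrite os// gs_step_ortho// mulr0 subrr.
Qed.

Lemma orthoproj_gram_schmidt a n : orthoproj (gram_schmidt a n).
Proof. by elim: n => [|n IHn] //=; exact: orthoproj_gs_step. Qed.

Lemma gram_schmidt_span a n j : (j < n)%N ->
  coord_sum (gram_schmidt a n) (a j) = a j.
Proof.
elim: n => // n IHn; rewrite ltnS leq_eqVlt => /orP[/eqP ->|jn] /=.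
  have os := @orthoproj_gram_schmidt a n; set s := gram_schmidt a n.
  rewrite /coord_sum big_cons -/(coord_sum s (a n)).
  set v := gs_step s (a n); set r := a n - coord_sum s (a n).
  have -> : inner (a n) v = `|r|.
    have -> : a n = r + coord_sum s (a n) by rewrite subrK.
    rewrite innerDl gs_step_ortho_sum// addr0 /v /gs_step -/r (innerC r) innerZl.
    have [->|r0] := eqVneq r 0; first by rewrite inner0l mulr0 normr0.
    by rewrite -normr_inner expr2 mulKf// normr_eq0.
  rewrite /v /gs_step -/r scalerA.
  have [r0|r0] := eqVneq r 0.
    by rewrite r0 scaler0 add0r; apply/esym/eqP; rewrite -subr_eq0 -/r r0.
  by rewrite mulfV ?normr_eq0// scale1r subrK.
rewrite /coord_sum big_cons -/(coord_sum _ (a j)) IHn//.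
rewrite -{1}(IHn jn) gs_step_ortho_sum ?scale0r ?add0r//.
exact: orthoproj_gram_schmidt.
Qed.

Lemma coord_sqr_gram_schmidt_nd a x :
  nondecreasing_seq (fun n => coord_sqr (gram_schmidt a n) x).
Proof.
by apply/nondecreasing_seqP => n; rewrite /coord_sqr big_cons lerDr sqr_ge0.
Qed.

Lemma separable_dense_seq (T : normedModType R) : separable_space T ->
  exists a : nat -> T, forall x (e : R), 0 < e -> exists n, `|x - a n| < e.
Proof.
move=> [A /countable_injP[f finj] dA].
exists (fun n => xget 0 [set x | A x /\ f x = n]) => x e e0.
have [|z [xz Az]] := dA (ball x e) _ (ball_open x e).
  by exists x; exact: ballxx.
exists (f z); case: xgetP => [y _ [Ay fyz]|/(_ z)]; last by case.
by rewrite (finj y z)// ?inE//; move: xz; rewrite -ball_normE.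
Qed.

(** Parseval: the span of the first [n] vectors contains [a j] for [j < n], so
    the defect in Bessel's inequality is at most [|x - a j|^2]. *)
Lemma coord_sqr_gram_schmidt_cvg a x :
    (forall e : R, 0 < e -> exists n, `|x - a n| < e) ->
  coord_sqr (gram_schmidt a n) x @[n --> \oo] --> `|x| ^+ 2.
Proof.
move=> ax; apply/cvgrPdist_le => e e0.
have [j xj] := ax (Num.sqrt e) ltac:(by rewrite sqrtr_gt0).
near=> n.
have os := @orthoproj_gram_schmidt a n.
rewrite ger0_norm ?subr_ge0 ?bessel//.
apply: le_trans (coord_sum_approx os x (gram_schmidt_span _ (j := j) _)) _.
  by near: n; exact: nbhs_infty_gt.
rewrite -(sqr_sqrtr (ltW e0)) ler_sqr ?nnegrE ?sqrtr_ge0//.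
exact: ltW.
Unshelve. all: by end_near. Qed.

End inner_product.

(** * Gaussian measures on a Hilbert space *)

Lemma integral_probability_cst d (T : measurableType d) (R : realType)
  (P : probability T R) (c : R) : (\int[P]_x c%:E = c%:E)%E.
Proof. by rewrite integral_cst//= probability_setT mule1. Qed.

Lemma continuous_borel_measurable (R : realType) (T : ptopologicalType) (f : T -> R) :
  continuous f -> measurable_fun [set: borel T] (f : borel T -> R).
Proof.
move=> /continuousP cf; apply: (measurability _ (RGenOpens.measurableE R)).
move=> _ [_ [a [b ->] <-]]; rewrite setTI; apply: sub_sigma_algebra.
exact/cf/interval_open.
Qed.

Lemma measurable_expR_sqr_norm (R : realType) (H : normedModType R) (c : R) :
  measurable_fun [set: borel H] (fun u : borel H => (expR (c * `|u| ^+ 2))%:E).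
Proof.
apply/measurable_EFinP; apply: measurableT_comp => //; apply: measurable_funM => //.
apply: continuous_borel_measurable => u.
apply: (cvg_comp _ (fun x : R => x ^+ 2)); last exact: exprn_continuous.
by apply: cvg_norm; exact: cvg_id.
Qed.

Section gaussian_norm.
Context (R : realType) (H : completeNormedModType R) (inner : {dot H for idfun}).
Hypothesis innerE : hilbert_inner inner.
Variables (m : H) (C : {linear H -> H}) (mu : probability (borel H) R).
Hypothesis gauss : is_gaussian inner mu m C.

Let lam h := inner (C h) h.

Let lam_ge0 h : 0 <= lam h. Proof. by case: gauss => _ _ + _; exact. Qed.

Let law h A : measurable A ->
  pushforward mu (fun u : borel H => inner u h) A = gaussian1 (inner m h) (lam h) A.
Proof. by case: gauss => _ _ _; apply. Qed.

Let measurable_inner h : measurable_fun [set: borel H] (fun u : borel H => inner u h).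
Proof. by apply: continuous_borel_measurable; exact: inner_continuous innerE h. Qed.

Let measurable_sqr_dist : measurable_fun [set: borel H] (fun u : borel H => `|u - m| ^+ 2).
Proof.
apply: continuous_borel_measurable => u.
apply: (cvg_comp _ (fun x : R => x ^+ 2)); last exact: exprn_continuous.
by apply: cvg_norm; apply: cvgB; [exact: cvg_id|exact: cvg_cst].
Qed.

Let measurable_coord_sqr s :
  measurable_fun [set: borel H] (fun u : borel H => coord_sqr inner s (u - m)).
Proof.
apply: measurable_sum => e; apply: measurable_funX.
under eq_fun do rewrite innerBl.
exact: measurable_funB.
Qed.

Lemma sqr_dist_tail (e : R) : 0 < e ->
  exists2 r : R, 0 <= r & (mu [set u | (r < `|u - m| ^+ 2)%R] <= e%:E)%E.
Proof.
move=> e0.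
pose X : {RV mu >-> R} := HB.pack (fun u : borel H => `|u - m| ^+ 2)
  (isMeasurableFun.Build _ _ _ _ _ measurable_sqr_dist).
have e0E : (0 < e%:E)%E by rewrite lte_fin.
have [M [_ XM]] := cvg_ccdfy0 X (open_ereal_lt' e0E).
exists (Num.max 0 M + 1); first by rewrite addr_ge0// le_max lexx.
have /XM/ltW : M < Num.max 0 M + 1.
  by rewrite (@le_lt_trans _ _ (Num.max 0 M)) ?ltrDl// le_max lexx orbT.
rewrite /ccdf /distribution /pushforward /=.
set r := Num.max 0 M + 1.
suff -> : [set u | r < `|u - m| ^+ 2] = X @^-1` `]r, +oo[ by [].
by apply/seteqP; split=> u; rewrite /= in_itv/= andbT.
Qed.

Let trace (s : seq H) := \sum_(e <- s) lam e.

Let trace_ge0 s : 0 <= trace s.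
Proof. by apply: sumr_ge0 => e _; exact: lam_ge0. Qed.

(** The covariance is trace-class.  Each coordinate is as large as half its
    standard deviation with probability at least [1/2], so the expected
    sum of the variances of such coordinates is at least half the trace.  On the
    other hand this sum is at most the trace, and by Bessel at most
    [4 |u - m|^2], which is bounded off an event of probability [1/4].  No
    joint law of several coordinates enters. *)
Lemma gaussian_trace_bounded :
  exists2 V : R, 0 <= V & forall s, orthoproj inner s -> trace s <= V.
Proof.
have [r r0 mur] := @sqr_dist_tail 4^-1 ltac:(by rewrite invr_gt0).
(* The two bounds combine to [T / 2 <= 4 r + T / 4] for the trace [T]. *)
exists (16 * r) => [|s os]; first by rewrite mulr_ge0.
pose B e := [set u : borel H | lam e < 4 * (inner u e - inner m e) ^+ 2].
pose D := [set u : borel H | r < `|u - m| ^+ 2].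
have mB e : measurable (B e).
  rewrite -[B e]setTI; apply: (measurable_fun_ltr (f := cst (lam e))) => //.
  apply: measurable_funM => //; apply: measurable_funX.
  exact: measurable_funB.
have mD : measurable D.
  rewrite -[D]setTI; apply: (measurable_fun_ltr (f := cst r)) => //.
have mlB e : measurable_fun [set: borel H] (fun u => (lam e * \1_(B e) u)%:E).
  by apply/measurable_EFinP/measurable_funM => //; exact: measurable_indic.
have lB0 e u : (0 <= (lam e * \1_(B e) u)%:E)%E.
  by rewrite lee_fin mulr_ge0 ?lam_ge0 ?indicE.
have low : ((trace s / 2)%:E <= \int[mu]_u (\sum_(e <- s) (lam e * \1_(B e) u)%:E))%E.
  rewrite ge0_integral_sum// /trace mulr_suml -sumEFin; apply: lee_sum => e _.
  under eq_integral do rewrite EFinM.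
  rewrite ge0_integralZl_EFin ?lam_ge0//; last first.
    by apply/measurable_EFinP; exact: measurable_indic.
  rewrite integral_indic// setIT EFinM.
  have [->|le0] := eqVneq (lam e) 0; first by rewrite !mul0e.
  rewrite lee_wpmul2l ?lee_fin ?lam_ge0//.
  apply: gaussian1_spread; [exact: measurable_inner|exact: lam_ge0|exact: law|].
  by rewrite lt_neqAle eq_sym le0 lam_ge0.
have up : (\int[mu]_u (\sum_(e <- s) (lam e * \1_(B e) u)%:E) <=
           \int[mu]_u ((4 * r)%:E + (trace s * \1_D u)%:E))%E.
  apply: ge0_le_integral => //.
  - by move=> u _; apply: sume_ge0 => e _.
  - exact: emeasurable_sum.
  - apply: emeasurable_funD => //; apply/measurable_EFinP/measurable_funM => //.
  - move=> u _; rewrite sumEFin -EFinD lee_fin [X in trace s * X]indicE.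
    have [uD|] := boolP (u \in D).
      rewrite mulr1 -[leLHS]add0r lerD ?mulr_ge0//; apply: ler_sum => e _.
      by rewrite ler_piMr ?lam_ge0// indicE lern1 leq_b1.
    rewrite notin_setE /D /= => /negP; rewrite -leNgt => ur.
    rewrite mulr0 addr0; apply: (@le_trans _ _ (4 * coord_sqr inner s (u - m))).
      rewrite /coord_sqr mulr_sumr; apply: ler_sum => e _.
      rewrite innerBl indicE; have [ue|_] := boolP (u \in B e).
        by rewrite mulr1 ltW//; move: ue; rewrite inE.
      by rewrite mulr0 mulr_ge0 ?sqr_ge0.
    by rewrite ler_wpM2l// (le_trans (bessel innerE os _)).
have := le_trans low up.
have mD1 : measurable_fun [set: borel H] (fun u => (trace s * \1_D u)%:E).
  by apply/measurable_EFinP/measurable_funM => //; exact: measurable_indic.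
have D10 u : (0 <= (trace s * \1_D u)%:E)%E by rewrite lee_fin mulr_ge0.
have r40 : (0 <= (4 * r)%:E)%E by rewrite lee_fin mulr_ge0.
rewrite ge0_integralD// integral_probability_cst.
under [in X in (_ <= _ + X)%E]eq_integral do rewrite EFinM.
rewrite ge0_integralZl_EFin//; last first.
  by apply/measurable_EFinP; exact: measurable_indic.
rewrite integral_indic// setIT => h.
have : ((trace s / 2)%:E <= (4 * r)%:E + (trace s)%:E * 4^-1%:E)%E.
  by apply: le_trans h _; rewrite leeD2l// lee_wpmul2l ?lee_fin.
by rewrite -EFinM -EFinD lee_fin; lra.
Qed.

(** Convexity of [exp] replaces independence: the weights are proportional to
    the variances, and each term then only involves the law of one
    coordinate. *)
Lemma coord_exp_moment V s : orthoproj inner s -> 0 <= V -> trace s <= V ->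
  (\int[mu]_u (expR ((4 * (V + 1))^-1 * coord_sqr inner s (u - m)))%:E <= 2%:E)%E.
Proof.
move=> os V0 sV; have V1 : 0 < V + 1 by rewrite ltr_wpDl.
(* [dl] keeps the weights of null variances positive. *)
pose dl : R := (size s).+1%:R^-1.
have dl0 : 0 < dl by rewrite invr_gt0.
have ldl e : 0 < lam e + dl by rewrite ltr_wpDl.
pose w e := (lam e + dl) / (V + 1).
have w0 e : 0 <= w e by rewrite divr_ge0// ltW.
pose c e := (4 * (lam e + dl))^-1.
have c0 e : 0 <= c e by rewrite invr_ge0 mulr_ge0// ltW.
set W := \sum_(e <- s) w e.
have W1 : W <= 1.
  rewrite /W -mulr_suml big_split/= -/(trace s) ler_pdivrMr// mul1r lerD//.
  rewrite big_const_seq count_predT iter_addr_0 -mulr_natl.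
  by rewrite /dl ler_pdivrMr// mul1r ler_nat.
have mX e : measurable_fun [set: borel H]
    (fun u : borel H => expR (c e * (inner u e - inner m e) ^+ 2)).
  apply: measurableT_comp => //; apply: measurable_funM => //.
  by apply: measurable_funX; exact: measurable_funB.
have mwX e : measurable_fun [set: borel H]
    (fun u : borel H => (w e * expR (c e * (inner u e - inner m e) ^+ 2))%:E).
  by apply/measurable_EFinP/measurable_funM.
have wX0 e (u : borel H) : (0 <= (w e * expR (c e * (inner u e - inner m e) ^+ 2))%:E)%E.
  by rewrite lee_fin mulr_ge0 ?expR_ge0.
apply: (@le_trans _ _ (\int[mu]_u
   (\sum_(e <- s) (w e * expR (c e * (inner u e - inner m e) ^+ 2))%:E + (1 - W)%:E))%E).
  apply: ge0_le_integral => //.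
  - apply/measurable_EFinP; apply: measurableT_comp => //.
    exact: measurable_funM.
  - by apply: emeasurable_funD => //; exact: emeasurable_sum.
  - move=> u _; rewrite sumEFin -EFinD lee_fin.
    apply: le_trans (expR_sum_le _ w0 W1); rewrite ler_expR /coord_sqr mulr_sumr.
    apply: ler_sum => e _; rewrite innerBl [leRHS]mulrA ler_wpM2r ?sqr_ge0//.
    rewrite /w /c le_eqVlt; apply/orP; left; apply/eqP; field.
    by apply/andP; split; [exact: lt0r_neq0 (ldl e)|exact: lt0r_neq0].
have W10 : (0 <= (1 - W)%:E)%E by rewrite lee_fin subr_ge0.
rewrite ge0_integralD//; last 2 first.
- by move=> u _; apply: sume_ge0.
- exact: emeasurable_sum.
rewrite integral_probability_cst ge0_integral_sum//.
apply: (@le_trans _ _ (\sum_(e <- s) (w e * 2)%:E + (1 - W)%:E)%E).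
  rewrite leeD2r//; apply: lee_sum => e _.
  under eq_integral do rewrite EFinM.
  rewrite ge0_integralZl_EFin//; last first.
    exact/measurable_EFinP.
  rewrite EFinM lee_wpmul2l ?lee_fin//.
  apply: (@gaussian1_exp_moment _ _ _ mu (fun u => inner u e) (inner m e) (lam e)) => //.
  - exact: law.
  - rewrite /c invfM -mulrA ler_piMr// mulrC ler_pdivrMr// mul1r lerDl ltW//.
by rewrite sumEFin -mulr_suml -/W -EFinD lee_fin; lra.
Qed.

(** Fernique's theorem.  The bound of [coord_exp_moment] does not depend on the
    family, so it passes to the limit along an orthonormalized dense sequence. *)
Lemma gaussian_exp_moment : separable_space H ->
  exists2 al : R, 0 < al & (\int[mu]_u (expR (al * `|u| ^+ 2))%:E < +oo)%E.
Proof.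
move=> /separable_dense_seq[a aP].
have [V V0 trV] := gaussian_trace_bounded.
pose ep := (4 * (V + 1))^-1.
have ep0 : 0 < ep by rewrite invr_gt0 mulr_gt0// ltr_wpDl.
pose S n (u : borel H) := coord_sqr inner (gram_schmidt inner a n) (u - m).
have mS n : measurable_fun [set: borel H] (S n) by exact: measurable_coord_sqr.
have limS u : (expR (ep * S n u))%:E @[n --> \oo] --> (expR (ep * `|u - m| ^+ 2))%:E.
  apply: cvg_EFin; first by near=> n.
  apply: (cvg_comp _ expR); last exact: continuous_expR.
  apply: cvgM; first exact: cvg_cst.
  by apply: coord_sqr_gram_schmidt_cvg => // e; exact: aP.
have dist : (\int[mu]_u (expR (ep * `|u - m| ^+ 2))%:E <= 2%:E)%E.
  under eq_integral do rewrite -(cvg_lim _ (limS _))//.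
  rewrite monotone_convergence//; last 2 first.
  - move=> n; apply/measurable_EFinP; apply: measurableT_comp => //.
    exact: measurable_funM.
  - move=> u _ n k nk; rewrite lee_fin ler_expR ler_wpM2l ?(ltW ep0)//.
    exact: coord_sqr_gram_schmidt_nd.
  apply: lime_le.
    apply: ereal_nondecreasing_is_cvgn => n k nk; apply: ge0_le_integral => //.
    - by apply/measurable_EFinP; apply: measurableT_comp => //; exact: measurable_funM.
    - by apply/measurable_EFinP; apply: measurableT_comp => //; exact: measurable_funM.
    - move=> u _; rewrite lee_fin ler_expR ler_wpM2l ?(ltW ep0)//.
      exact: coord_sqr_gram_schmidt_nd.
  near=> n; apply: coord_exp_moment => //; first exact: orthoproj_gram_schmidt.
  by apply: trV; exact: orthoproj_gram_schmidt.
(* [|u|^2 <= 2 |u - m|^2 + 2 |m|^2] *)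
exists (ep / 2); first by rewrite divr_gt0.
apply: (@le_lt_trans _ _ ((expR (ep * `|m| ^+ 2))%:E * 2%:E)%E); last first.
  by rewrite -EFinM ltry.
apply: le_trans (lee_wpmul2l _ dist); last by rewrite lee_fin expR_ge0.
have md : measurable_fun [set: borel H] (fun u : borel H => (expR (ep * `|u - m| ^+ 2))%:E).
  by apply/measurable_EFinP; apply: measurableT_comp => //; exact: measurable_funM.
rewrite -ge0_integralZl_EFin ?expR_ge0//.
apply: ge0_le_integral => //.
- exact: measurable_expR_sqr_norm.
- by apply: emeasurable_funM.
- move=> u _; rewrite -EFinM lee_fin -expRD ler_expR.
  have um : `|u| <= `|u - m| + `|m| by rewrite -{1}(subrK m u) ler_normD.
  have : `|u| ^+ 2 <= (`|u - m| + `|m|) ^+ 2 by rewrite ler_sqr ?nnegrE ?addr_ge0.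
  have := sqr_ge0 (`|u - m| - `|m|); nra.
Unshelve. all: by end_near. Qed.

End gaussian_norm.

(** * Differentiation of tilted integrals *)

Section tilt.
Context d (T : measurableType d) (R : realType) (mu : probability T R).
Variable Phi : T -> R.
Hypothesis mPhi : measurable_fun [set: T] Phi.
Hypothesis Phi0 : forall u, 0 <= Phi u.

Definition tilt (f : T -> R) (t : R) : R :=
  \int[mu]_u (f u * expR (- (t * Phi u))).

Let mexp t : measurable_fun [set: T] (fun u => expR (- (t * Phi u))).
Proof.
by apply: measurableT_comp => //; apply: measurableT_comp => //; exact: measurable_funM.
Qed.

Lemma integrable_tilt (f : T -> R) t : 0 <= t ->
  mu.-integrable [set: T] (EFin \o f) ->
  mu.-integrable [set: T] (EFin \o (fun u => f u * expR (- (t * Phi u)))).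
Proof.
move=> t0 fi; apply: (le_integrable measurableT _ _ fi).
  apply/measurable_EFinP; apply: measurable_funM => //.
  by move/measurable_int: fi => /measurable_EFinP.
move=> u _ /=; rewrite lee_fin normrM ler_piMr// ger0_norm ?expR_ge0//.
by rewrite -expR0 ler_expR oppr_le0 mulr_ge0.
Qed.

Section derivative.
Variable f : T -> R.
Hypothesis fi : mu.-integrable [set: T] (EFin \o f).
Hypothesis fPi : mu.-integrable [set: T] (EFin \o (fun u => f u * Phi u)).
Hypothesis fPPi : mu.-integrable [set: T] (EFin \o (fun u => f u * Phi u ^+ 2)).

(** The second order bound [expRN_taylor2] is integrated against [f].  The
    remainder is uniform up to the boundary [t = 0]. *)
Lemma tilt_remainder s t : 0 <= s -> 0 <= t ->
  `|tilt f s - tilt f t + (s - t) * tilt (fun u => f u * Phi u) t| <=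
    (s - t) ^+ 2 * \int[mu]_u `|f u * Phi u ^+ 2|.
Proof.
move=> s0 t0; rewrite /tilt.
have is_ := integrable_tilt s0 fi; have it := integrable_tilt t0 fi.
have itP := integrable_tilt t0 fPi.
have istP : mu.-integrable [set: T]
    (EFin \o (fun u => (s - t) * (f u * Phi u * expR (- (t * Phi u))))).
  by have := integrableZl measurableT (s - t) itP; apply: eq_integrable.
have id : mu.-integrable [set: T]
    (EFin \o (fun u => f u * expR (- (s * Phi u)) - f u * expR (- (t * Phi u)))).
  by have := integrableB measurableT is_ it; apply: eq_integrable.
have iabs : mu.-integrable [set: T] (EFin \o (fun u => `|f u * Phi u ^+ 2|)).
  by have := integrable_abse fPPi; apply: eq_integrable.
rewrite -RintegralZl// -RintegralB// -RintegralD// -RintegralZl//.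
have isum : mu.-integrable [set: T] (EFin \o (fun u =>
    f u * expR (- (s * Phi u)) - f u * expR (- (t * Phi u)) +
    (s - t) * (f u * Phi u * expR (- (t * Phi u))))).
  by have := integrableD measurableT id istP; apply: eq_integrable.
apply: le_trans (le_normr_Rintegral measurableT isum) _.
apply: le_Rintegral => //.
- by have := integrable_abse isum; apply: eq_integrable.
- by have := integrableZl measurableT ((s - t) ^+ 2) iabs; apply: eq_integrable.
- move=> u _; have := expRN_taylor2 (mulr_ge0 t0 (Phi0 u)) (mulr_ge0 s0 (Phi0 u)).
  set es := expR _; set et := expR _ => h.
  have -> : f u * es - f u * et + (s - t) * (f u * Phi u * et) =
    f u * (es - et + (s * Phi u - t * Phi u) * et) by ring.
  rewrite [in leLHS]normrM [in leRHS](normrM (f u)) (ger0_norm (sqr_ge0 (Phi u))).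
  rewrite mulrCA ler_wpM2l//.
  by apply: le_trans h _; rewrite -mulrBl exprMn.
Qed.

Lemma tilt_diff_quotient_cvg (F : set_system R) {FF : Filter F} t : 0 <= t ->
    h @[h --> F] --> (0 : R) -> (\forall h \near F, h != 0) ->
    (\forall h \near F, 0 <= t + h) ->
  h^-1 * (tilt f (t + h) - tilt f t) @[h --> F] -->
    - tilt (fun u => f u * Phi u) t.
Proof.
move=> t0 F0 Fn Ft; set B := \int[mu]_u `|f u * Phi u ^+ 2|.
have hB : `|h| * B @[h --> F] --> (0 : R).
  rewrite -[X in _ --> X](mul0r B) -(normr0 R); apply: cvgM; last exact: cvg_cst.
  exact: cvg_norm.
apply/cvgrPdist_le => e e0.
move/cvgrPdist_le: hB => /(_ e e0) hB.
near=> h.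
have h0 : h != 0 by near: h.
have th : 0 <= t + h by near: h.
have hR := tilt_remainder th t0; have ht : t + h - t = h by ring.
rewrite ht -/B in hR.
have hBe : `|h| * B <= e.
  near: h; apply: filterS hB => x; rewrite sub0r normrN.
  exact: le_trans (ler_norm _).
apply: (le_trans _ hBe).
have hn : 0 < `|h| by rewrite normr_gt0.
rewrite -(ler_pM2l hn) -normrM mulrA -expr2 real_normK ?num_real//.
rewrite -normrN; apply: (le_trans _ hR); rewrite le_eqVlt; apply/orP; left; apply/eqP.
by congr (`| _ |); field.
Unshelve. all: by end_near. Qed.

End derivative.
End tilt.

(** The quotient rule for difference quotients along an arbitrary filter, which
    covers two-sided and one-sided derivatives at once. *)
Lemma ratio_diff_quotient_cvg (R : realType) (F : set_system R) {FF : Filter F}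
    (a n : R -> R) (a0 n0 a' n' : R) :
    h @[h --> F] --> (0 : R) -> (\forall h \near F, h != 0) -> n0 != 0 ->
    (\forall h \near F, n h != 0) ->
    h^-1 * (a h - a0) @[h --> F] --> a' ->
    h^-1 * (n h - n0) @[h --> F] --> n' ->
  h^-1 * (a h / n h - a0 / n0) @[h --> F] --> (a' * n0 - a0 * n') / n0 ^+ 2.
Proof.
move=> F0 Fn n00 nn ca cn.
have cn0 : n h @[h --> F] --> n0.
  have : n0 + h * (h^-1 * (n h - n0)) @[h --> F] --> n0 + 0 * n'.
    by apply: cvgD; [exact: cvg_cst|exact: cvgM].
  rewrite mul0r addr0; apply: cvg_trans; apply: near_eq_cvg.
  by near=> h; rewrite mulVKf ?subrKC//; near: h.
have : (h^-1 * (a h - a0) * n0 - a0 * (h^-1 * (n h - n0))) / (n h * n0) @[h --> F]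
    --> (a' * n0 - a0 * n') / n0 ^+ 2.
  apply: cvgM.
    by apply: cvgB; apply: cvgM => //; exact: cvg_cst.
  rewrite expr2; apply: cvgV; first by rewrite mulf_neq0.
  by apply: cvgM => //; exact: cvg_cst.
apply: cvg_trans; apply: near_eq_cvg; near=> h.
field; rewrite n00/=; apply/andP; split; by near: h.
Unshelve. all: by end_near. Qed.

(** * Tempered measures *)

Section tempered.
Context d (T : measurableType d) (R : realType) (mu0 : probability T R).
Variable Phi : T -> R.
Hypothesis mPhi : measurable_fun [set: T] Phi.
Hypothesis Phi0 : forall u, 0 <= Phi u.

Definition tempered_mean (f : T -> R) (t : R) : R :=
  tilt mu0 Phi f t / tempered_const mu0 Phi t.

Lemma tempered_constE : tempered_const mu0 Phi = tilt mu0 Phi (cst 1).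
Proof.
by apply/funext => t; apply: eq_Rintegral => u _; rewrite /= mul1r.
Qed.

Section measure.
Variables (t : R) (mu : probability T R).
Hypothesis t0 : 0 <= t.
Hypothesis mut : is_tempered mu0 Phi t mu.

Let rho u := (tempered_const mu0 Phi t)^-1 * expR (- (t * Phi u)).

Let tempered_const_ge0 : 0 <= tempered_const mu0 Phi t.
Proof. by apply: Rintegral_ge0 => u _; exact: expR_ge0. Qed.

(** As [0^-1 = 0], a null normalization would give the tempered measure a null
    density. *)
Lemma tempered_const_gt0 : 0 < tempered_const mu0 Phi t.
Proof.
rewrite lt_neqAle eq_sym tempered_const_ge0 andbT; apply/eqP => N0.
have := mut measurableT; rewrite probability_setT N0 invr0.
under eq_integral do rewrite mul0r.
by rewrite integral0 => /eqP; rewrite onee_eq0.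
Qed.

Let mrho : measurable_fun [set: T] rho.
Proof.
apply: measurable_funM => //; apply: measurableT_comp => //.
by apply: measurableT_comp => //; exact: measurable_funM.
Qed.

Let rho0 u : 0 <= rho u.
Proof. by rewrite mulr_ge0 ?invr_ge0 ?expR_ge0. Qed.

Variable f : T -> R.
Hypothesis fi : mu0.-integrable [set: T] (EFin \o f).

Let mf : measurable_fun [set: T] f.
Proof. by move/measurable_int: fi => /measurable_EFinP. Qed.

Let frhoE : (fun u => (f u * rho u)%:E) =
  (fun u => ((tempered_const mu0 Phi t)^-1)%:E * (f u * expR (- (t * Phi u)))%:E)%E.
Proof. by apply/funext => u; rewrite -EFinM mulrCA. Qed.

Let ftilt := integrable_tilt mPhi Phi0 t0 fi.

Lemma tempered_integrable : mu.-integrable [set: T] (EFin \o f).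
Proof.
apply: (integrable_density mrho rho0 mut) => //.
by rewrite frhoE; exact: integrableZl.
Qed.

Lemma integral_tempered : (\int[mu]_u (f u)%:E = (tempered_mean f t)%:E)%E.
Proof.
rewrite (integral_density mrho rho0 mut)// frhoE integralZl//.
rewrite /tempered_mean mulrC EFinM /tilt /Rintegral fineK//.
exact: integrable_fin_num.
Qed.

Section law.
Context d' (W : measurableType d') (P : probability W R) (U : {RV P >-> T}).
Hypothesis Ulaw : forall A, measurable A -> distribution P U A = mu A.

Let Uf : P.-integrable [set: W] (EFin \o (f \o U)).
Proof.
have /integrableP[_ fin] := tempered_integrable.
apply/integrableP; split; first exact/measurable_EFinP/measurableT_comp.
move: fin; rewrite (eq_measure_integral (distribution P U)); last first.
  by move=> A mA _; exact/esym/Ulaw.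
rewrite ge0_integral_distribution//.
by apply: measurableT_comp => //; exact/measurable_EFinP.
Qed.

Lemma law_Lfun : f \o U \in Lfun P 1%E.
Proof. exact/Lfun1_integrable. Qed.

Lemma law_expectation : 'E_P[f \o U]%E = (tempered_mean f t)%:E.
Proof.
rewrite unlock -integral_tempered (eq_measure_integral (distribution P U)); last first.
  by move=> A mA _; exact/esym/Ulaw.
by rewrite integral_distribution//; exact/measurable_EFinP.
Qed.

End law.
End measure.

Section derivative.
Variable f : T -> R.
Hypothesis f_Phi : forall k, (k <= 2)%N ->
  mu0.-integrable [set: T] (EFin \o (fun u => f u * Phi u ^+ k)).
Hypothesis Phi_k : forall k, (k <= 2)%N ->
  mu0.-integrable [set: T] (EFin \o (fun u => Phi u ^+ k)).

(** The two hypotheses are what [tilt_remainder] asks of the numerator and of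
    the denominator. *)
Lemma tempered_mean_derivative (F : set_system R) {FF : Filter F} t :
    (forall s, 0 <= s -> 0 < tempered_const mu0 Phi s) -> 0 <= t ->
    h @[h --> F] --> (0 : R) -> (\forall h \near F, h != 0) ->
    (\forall h \near F, 0 <= t + h) ->
  h^-1 * (tempered_mean f (t + h) - tempered_mean f t) @[h --> F] -->
    - (tempered_mean (fun u => f u * Phi u) t -
       tempered_mean f t * tempered_mean Phi t).
Proof.
move=> N0 t0 F0 Fn Ft.
have fk k : (k <= 2)%N -> mu0.-integrable [set: T]
    (EFin \o (fun u => (cst 1 u : R) * Phi u ^+ k)).
  by move=> /Phi_k; apply: eq_integrable => // u _; rewrite /= mul1r.
have nt := N0 _ t0.
have f0 : mu0.-integrable [set: T] (EFin \o f).
  by have := @f_Phi 0 isT; apply: eq_integrable => // u _; rewrite /= expr0 mulr1.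
have c0 : mu0.-integrable [set: T] (EFin \o (cst 1 : T -> R)).
  by have := @Phi_k 0 isT; apply: eq_integrable => // u _; rewrite /= expr0.
have dnum := tilt_diff_quotient_cvg mPhi Phi0 f0 (@f_Phi 1 isT) (@f_Phi 2 isT) t0 F0 Fn Ft.
have dden := tilt_diff_quotient_cvg mPhi Phi0 c0 (@fk 1%N isT) (@fk 2%N isT) t0 F0 Fn Ft.
rewrite -tempered_constE in dden.
have -> : - (tempered_mean (fun u => f u * Phi u) t -
    tempered_mean f t * tempered_mean Phi t) =
  (- tilt mu0 Phi (fun u => f u * Phi u) t * tempered_const mu0 Phi t -
   tilt mu0 Phi f t * - tilt mu0 Phi (fun u => cst 1 u * Phi u) t) /
   tempered_const mu0 Phi t ^+ 2.
  have -> : (fun u => cst 1 u * Phi u) = Phi by apply/funext => u; rewrite /= mul1r.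
  by rewrite /tempered_mean; field; rewrite gt_eqF.
apply: (@ratio_diff_quotient_cvg _ _ _ (fun h => tilt mu0 Phi f (t + h))
  (fun h => tempered_const mu0 Phi (t + h))) => //.
- by rewrite gt_eqF.
- by apply: filterS Ft => h /N0; rewrite lt_neqAle eq_sym => /andP[].
- exact: dnum.
- exact: dden.
Qed.

End derivative.
End tempered.

(** * The data misfit *)

Section misfit.
Context (R : realType) (H : completeNormedModType R) (M : nat).
Variables (Gamma : 'M[R]_M) (G : H -> 'cV[R]_M) (y : 'cV[R]_M).

Let S := inv_sqrtmx Gamma.

Lemma enorm_sqr n (v : 'cV[R]_n) : enorm v ^+ 2 = \sum_(i < n) v i 0 ^+ 2.
Proof. by rewrite sqr_sqrtr// sumr_ge0// => i _; exact: sqr_ge0. Qed.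

Lemma coord_le_enorm n (v : 'cV[R]_n) i : `|v i 0| <= enorm v.
Proof.
rewrite -sqrtr_sqr ler_wsqrtr// (bigD1 i)//= lerDl.
by apply: sumr_ge0 => j _; exact: sqr_ge0.
Qed.

Lemma misfit_ge0 u : 0 <= misfit Gamma G y u.
Proof. by rewrite mulr_ge0 ?invr_ge0 ?sqr_ge0. Qed.

Lemma misfit_le u :
  misfit Gamma G y u <= enorm (S *m y) ^+ 2 + enorm (S *m G u) ^+ 2.
Proof.
rewrite /misfit -/S mulmxBr !enorm_sqr mulr_sumr -big_split/=.
apply: ler_sum => i _; rewrite !mxE.
set a := \sum_j _; set b := \sum_j _.
have := sqr_ge0 (a + b); nra.
Qed.

(** The ball of radius [|u| + 1] around the origin is a neighborhood of [u]. *)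
Lemma locally_lipschitz_continuous (f : H -> R) :
    (forall r : R, 0 < r -> exists2 K : R, 0 < K &
      forall u1 u2 : H, Num.max `|u1| `|u2| < r -> `|f u1 - f u2| <= K * `|u1 - u2|) ->
  continuous f.
Proof.
move=> fL u; have r0 : 0 < `|u| + 1 by rewrite ltr_wpDl.
have [K K0 fK] := fL _ r0.
apply/cvgrPdist_lt => e e0; near=> v.
have uv : `|u - v| < 1 by near: v; exact: cvgr_dist_lt.
apply: (@le_lt_trans _ _ (K * `|u - v|)).
  apply: fK; rewrite gt_max ltrDl ltr01/=.
  have -> : v = u - (u - v) by rewrite subKr.
  by rewrite (le_lt_trans (ler_normB _ _))// ltrD2l.
rewrite -ltr_pdivlMl// mulrC; near: v; apply: cvgr_dist_lt => //.
by rewrite divr_gt0.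
Unshelve. all: by end_near. Qed.

Hypothesis G_growth : forall eps : R, 0 < eps -> exists beta : R, forall u : H,
     enorm (inv_sqrtmx Gamma *m G u) <= expR (eps * `|u| ^+ 2 + beta).
Hypothesis G_lipschitz : forall r : R, 0 < r -> exists2 K : R, 0 < K &
     forall u1 u2 : H, Num.max `|u1| `|u2| < r ->
     enorm (inv_sqrtmx Gamma *m (G u1 - G u2)) <= K * `|u1 - u2|.

Lemma misfit_continuous : continuous (misfit Gamma G y).
Proof.
have cS i : continuous (fun u => (S *m G u) i 0).
  apply: locally_lipschitz_continuous => r /G_lipschitz[K K0 GK]; exists K => // u1 u2 /GK.
  by apply: le_trans; rewrite mulmxBr -/S; have := coord_le_enorm (S *m G u1 - S *m G u2) i;
    rewrite !mxE.
have -> : misfit Gamma G y =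
    fun u => 2^-1 * \sum_(i < M) ((S *m y) i 0 - (S *m G u) i 0) ^+ 2.
  apply/funext => u; rewrite /misfit -/S mulmxBr enorm_sqr; congr (_ * _).
  by apply: eq_bigr => i _; rewrite !mxE.
move=> u; apply: cvgM; first exact: cvg_cst.
apply: cvg_big => [|i _]; first exact: add_continuous.
apply: (cvg_comp _ (fun x : R => x ^+ 2)); last exact: exprn_continuous.
by apply: cvgB; [exact: cvg_cst|exact: cS].
Qed.

(** Since [G] grows more slowly than [exp (eps |u|^2)] for every [eps], so does
    every power of the misfit. *)
Lemma misfit_pow4_growth (eps : R) : 0 < eps ->
  exists2 c : R, 0 <= c & forall u, misfit Gamma G y u ^+ 4 <= c * expR (eps * `|u| ^+ 2).
Proof.
move=> e0.
(* The misfit is quadratic in [G], and its fourth power is taken. *)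
have [beta Gb] := G_growth (divr_gt0 e0 (ltr0Sn R 7)).
set b := enorm (S *m y) ^+ 2; have b0 : 0 <= b by exact: sqr_ge0.
exists ((b + expR (2 * beta)) ^+ 4); first by rewrite exprn_ge0// addr_ge0 ?expR_ge0.
move=> u; set x := eps * `|u| ^+ 2.
have x0 : 0 <= x by rewrite mulr_ge0 ?sqr_ge0// ltW.
have -> : expR x = expR (x / 4) ^+ 4 by rewrite -expRM_natl; congr expR; field.
rewrite -exprMn; apply: lerXn2r; rewrite ?nnegrE ?misfit_ge0//.
  by rewrite mulr_ge0 ?addr_ge0 ?expR_ge0.
apply: le_trans (misfit_le u) _; rewrite -/b mulrDl lerD//.
  rewrite ler_peMr// -expR0 ler_expR divr_ge0//.
apply: (@le_trans _ _ (expR (x / 8 + beta) ^+ 2)).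
  apply: lerXn2r; rewrite ?nnegrE ?sqrtr_ge0 ?expR_ge0//.
  by apply: le_trans (Gb u) _; rewrite ler_expR lerD2r /x mulrAC.
rewrite -expRM_natl -expRD ler_expR; lra.
Qed.

End misfit.

(** * Integrability from second and fourth moments *)

(** Young's inequality and interpolation of powers: products of a square
    integrable function with the first two powers of a function with finite
    fourth moment are integrable. *)
Lemma integrable_mul_pow d (T : measurableType d) (R : realType)
    (mu : probability T R) (g Phi : T -> R) (k : nat) :
    measurable_fun [set: T] g -> measurable_fun [set: T] Phi ->
    mu.-integrable [set: T] (EFin \o (fun u => g u ^+ 2)) ->
    mu.-integrable [set: T] (EFin \o (fun u => Phi u ^+ 4)) -> (k <= 2)%N ->
  mu.-integrable [set: T] (EFin \o (fun u => g u * Phi u ^+ k)).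
Proof.
move=> mg mPhi ig iPhi k2.
have i1 : mu.-integrable [set: T] (EFin \o (fun=> 1 : R)).
  by apply: finite_measure_integrable_cst.
have := integrableD measurableT (integrableD measurableT i1 ig) iPhi.
apply: le_integrable => //.
  by apply/measurable_EFinP/measurable_funM => //; exact: measurable_funX.
move=> u _ /=; rewrite lee_fin [leRHS]ger0_norm; last first.
  by rewrite !addr_ge0 ?sqr_ge0// exprn_even_ge0.
have young a b : `|a * b| <= a ^+ 2 + b ^+ 2 :> R.
  by rewrite ler_norml; have := sqr_ge0 (a + b); have := sqr_ge0 (a - b);
    move=> ? ?; apply/andP; split; nra.
apply: le_trans (young _ _) _; rewrite [leLHS]addrC [leRHS]addrAC lerD2r -exprM.
have p4 : Phi u ^+ 4 = (Phi u ^+ 2) ^+ 2 by rewrite -exprM.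
case: k k2 => [|[|[|//]]] _.
- by rewrite mul0n expr0 lerDl p4 sqr_ge0.
- by rewrite mul1n p4; have := sqr_ge0 (Phi u ^+ 2 - 1); nra.
- by rewrite lerDr.
Qed.

Lemma integrable_sqr d (T : measurableType d) (R : realType)
    (mu : probability T R) (g : T -> R) :
  measurable_fun [set: T] g -> (\int[mu]_u (`|g u| ^+ 2)%:E < +oo)%E ->
  mu.-integrable [set: T] (EFin \o (fun u => g u ^+ 2)).
Proof.
move=> mg g2; apply/integrableP; split.
  by apply/measurable_EFinP; exact: measurable_funX.
apply: le_lt_trans g2; rewrite le_eqVlt; apply/orP; left; apply/eqP.
by apply: eq_integral => u _; rewrite /= normrX.
Qed.

Theorem theorem1 (R : realType) (H : completeNormedModType R)
  (inner : {dot H for idfun})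
  (H_hilbert : hilbert_inner inner) (H_separable : separable_space H)
  (m : H) (C : {linear H -> H}) (mu0 : probability (borel H) R)
  (mu0_gaussian : is_gaussian inner mu0 m C)
  (M : nat) (M_gt0 : (0 < M)%N) (y : 'cV[R]_M)
  (Gamma : 'M[R]_M) (Gamma_posdef : posdefmx Gamma)
  (G : H -> 'cV[R]_M)
  (G_growth : forall eps : R, 0 < eps -> exists beta : R, forall u : H,
     enorm (inv_sqrtmx Gamma *m G u) <= expR (eps * `|u| ^+ 2 + beta))
  (G_lipschitz : forall r : R, 0 < r -> exists2 K : R, 0 < K &
     forall u1 u2 : H, Num.max `|u1| `|u2| < r ->
     enorm (inv_sqrtmx Gamma *m (G u1 - G u2)) <= K * `|u1 - u2|)
  (mu : R -> probability (borel H) R)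
  (mu_tempered : forall t : R, 0 <= t ->
     is_tempered mu0 (misfit Gamma G y) t (mu t))
  (g : borel H -> R) (g_measurable : measurable_fun [set: borel H] g)
  (g_square : (\int[mu0]_u (`|g u| ^+ 2)%:E < +oo)%E)
  (d : R -> measure_display) (Omega : forall t : R, measurableType (d t))
  (P : forall t : R, probability (Omega t) R)
  (U : forall t : R, {RV (P t) >-> borel H})
  (U_law : forall t : R, 0 <= t -> forall A : set (borel H), measurable A ->
     distribution (P t) (U t) A = mu t A) :
  let Phi := misfit Gamma G y in
  let Eg := fun t : R => fine ('E_(P t)[g \o U t])%E in
  let Cov := fun t : R => fine (covariance (P t) (g \o U t) (Phi \o U t)) in
  [/\ (* all the expectations involved are those of integrable variables *)
      forall t : R, 0 <= t ->
        [/\ g \o U t \in Lfun (P t) 1%E, Phi \o U t \in Lfun (P t) 1%E &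
            ((g \o U t) * (Phi \o U t))%R \in Lfun (P t) 1%E],
      forall t : R, 0 <= t ->
        ('E_(P t)[g \o U t] = \int[mu t]_u (g u)%:E)%E,
      forall t : R, 0 < t -> is_derive t (1 : R) Eg (- Cov t) &
      h^-1 * (Eg h - Eg 0) @[h --> 0^'+] --> - Cov 0].
Proof.
move=> Phi Eg Cov.
have mPhi : measurable_fun [set: borel H] (Phi : borel H -> R).
  by apply: continuous_borel_measurable; exact: (misfit_continuous G_lipschitz).
have Phi0 u : 0 <= Phi u by exact: misfit_ge0.
have g2 := integrable_sqr g_measurable g_square.
have Phi4 : mu0.-integrable [set: borel H] (EFin \o (fun u => Phi u ^+ 4)).
  have [al al0 fernique] := gaussian_exp_moment H_hilbert mu0_gaussian H_separable.
  have [c c0 Phic] := misfit_pow4_growth y G_growth al0.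
  have mnorm := @measurable_expR_sqr_norm R H al.
  have ic : mu0.-integrable [set: borel H] (fun u => c%:E * (expR (al * `|u| ^+ 2))%:E)%E.
    apply: integrableZl => //; apply/integrableP; split => //.
    by under eq_integral do rewrite gee0_abs ?lee_fin ?expR_ge0//.
  apply: le_integrable ic => //.
    by apply/measurable_EFinP; exact: measurable_funX.
  move=> u _ /=; rewrite lee_fin ger0_norm ?exprn_ge0//.
  by apply: le_trans (Phic u) _; exact: ler_norm.
have gPhi k : (k <= 2)%N ->
    mu0.-integrable [set: borel H] (EFin \o (fun u => g u * Phi u ^+ k)).
  exact: (integrable_mul_pow g_measurable mPhi g2 Phi4).
(* The powers of [Phi] alone are the case [g = 1]. *)
have i1 : mu0.-integrable [set: borel H] (EFin \o (fun=> 1 ^+ 2 : R)).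
  exact: finite_measure_integrable_cst.
have Phik k : (k <= 2)%N ->
    mu0.-integrable [set: borel H] (EFin \o (fun u => Phi u ^+ k)).
  move=> k2.
  have := @integrable_mul_pow _ _ _ mu0 (cst 1) Phi k (measurable_cst _) mPhi i1 Phi4 k2.
  by apply: eq_integrable => // u _; rewrite /= mul1r.
have ig : mu0.-integrable [set: borel H] (EFin \o g).
  by have := gPhi 0%N isT; apply: eq_integrable => // u _; rewrite /= expr0 mulr1.
have iPhi : mu0.-integrable [set: borel H] (EFin \o Phi) by exact: (Phik 1%N isT).
have igPhi : mu0.-integrable [set: borel H] (EFin \o (fun u => g u * Phi u)).
  exact: (gPhi 1%N isT).
have lf t f (t0 : 0 <= t) (fi : mu0.-integrable [set: borel H] (EFin \o f)) :=
  law_Lfun mPhi Phi0 t0 (mu_tempered _ t0) fi (U_law _ t0).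
have le t f (t0 : 0 <= t) (fi : mu0.-integrable [set: borel H] (EFin \o f)) :=
  law_expectation mPhi Phi0 t0 (mu_tempered _ t0) fi (U_law _ t0).
have EgE t : 0 <= t -> Eg t = tempered_mean mu0 Phi g t.
  by move=> t0; rewrite /Eg le.
have CovE t : 0 <= t -> Cov t = tempered_mean mu0 Phi (fun u => g u * Phi u) t -
    tempered_mean mu0 Phi g t * tempered_mean mu0 Phi Phi t.
  move=> t0; rewrite /Cov covarianceE; [|exact: lf..|exact: (lf _ _ t0 igPhi)].
  by rewrite (le _ _ t0 ig) (le _ _ t0 iPhi) (le _ _ t0 igPhi) -EFinM -EFinB.
have N0 t : 0 <= t -> 0 < tempered_const mu0 Phi t.
  by move=> t0; exact: tempered_const_gt0 (mu_tempered _ t0).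
have dEg (F : set_system R) (FF : Filter F) t : 0 <= t ->
    h @[h --> F] --> (0 : R) -> (\forall h \near F, h != 0) ->
    (\forall h \near F, 0 <= t + h) ->
    h^-1 * (Eg (t + h) - Eg t) @[h --> F] --> - Cov t.
  move=> t0 F0 Fn Ft; rewrite CovE//.
  have /(_ FF) := tempered_mean_derivative mPhi Phi0 gPhi Phik N0 t0 F0 Fn Ft.
  apply: cvg_trans; apply: near_eq_cvg; apply: filterS Ft => h th.
  by rewrite !EgE.
split.
- move=> t t0; split; [exact: lf|exact: lf|exact: (lf _ _ t0 igPhi)].
- move=> t t0; rewrite le// (integral_tempered mPhi Phi0 t0 (mu_tempered _ t0) ig)//.
- move=> t t0.
  have dq : h^-1 *: (Eg (h *: 1 + t) - Eg t) @[h --> 0^'] --> - Cov t.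
    have -> : (fun h => h^-1 *: (Eg (h *: 1 + t) - Eg t)) =
        (fun h => h^-1 * (Eg (t + h) - Eg t)).
      by apply/funext => h; rewrite [h *: 1]mulr1 [h + t]addrC.
    apply: dEg; [exact: ltW|exact: cvg_within|exact: nbhs_dnbhs_neq|].
    near=> h.
    have : `|h| < t by near: h; exact: dnbhs0_lt.
    by rewrite ltr_norml => /andP[]; lra.
  apply: DeriveDef; first by apply/cvg_ex; exists (- Cov t).
  exact: cvg_lim dq.
- have -> : (fun h => h^-1 * (Eg h - Eg 0)) = (fun h => h^-1 * (Eg (0 + h) - Eg 0)).
    by apply/funext => h; rewrite add0r.
  apply: dEg; [exact: lexx|exact: cvg_within| |].
    by near=> h; rewrite gt_eqF.
  by near=> h; rewrite add0r ltW.
Unshelve. all: by end_near. Qed.
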